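(* Let $F:\mathcal{R}\times\mathcal{O}\to\mathcal{R}$ be the transition map of the runtime (with fixed model parameters $\theta$), let $R_0=R_{\mathrm{init}}$, let $o_1,\dots,o_T$ be the observation stream, let $R_t=F(R_{t-1},o_t;\theta)$ for $1\le t\le T$ be the real trajectory, let $z$ be a forget target first entering at step $\tau$ ($1\le\tau\le T$), and let $\{R^{-z}_t\}_{0\le t\le T}$ be the counterfactual trajectory induced by the counterfactual observation stream $o^{-z}$. Suppose a checkpoint exists at $\tau-1$ (or at any earlier clean boundary). Given sanitized observations $\tilde o_t$ for $\tau\le t\le T$, define the replayed trajectory by $$\tilde R_{\tau-1}=R_{\tau-1},\qquad \tilde R_t=F(\tilde R_{t-1},\tilde o_t;\theta)\quad\text{for } \tau\le t\le T.$$ Assume: (A1) decoding is deterministic (or the randomness source is fixed), so that $F$ is single-valued; (A2) the sanitized observations agree with the counterfactual ones: $\tilde o_t=o^{-z}_t$ for all $\tau\le t\le T$; (A3) no committed external side effects exist after $\tau$ (the environment can be restored from a snapshot, so that the tool observations in (A2) are reproducible during replay). Then $\tilde R_t=R^{-z}_t$ for all $\tau-1\le t\le T$. In particular $\tilde R_T=R^{-z}_T$, i.e. the splicing operator, which maps $(R_T,z)$ to $\tilde R_T$, is an exact unlearning operator.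
   Context: Runtime as a transition system. $\mathcal{R}$ is the set of runtime states and $\mathcal{O}$ the set of observations; each observation is a collection (set) of items. A session of length $T$ is the trajectory $R_t=F(R_{t-1},o_t;\theta)$, $t=1,\dots,T$, $R_0=R_{\mathrm{init}}$, where $o_1,\dots,o_T\in\mathcal{O}$ are the external observations and $\theta$ is fixed. Transition $t$ consumes $o_t$ and produces $R_t$. Forget target. $z$ is an item that first enters at step $\tau\ge1$: $z\in o_\tau$ and $z\notin o_t$ for all $t<\tau$. Counterfactual stream and trajectory. $o^{-z}=(o^{-z}_1,\dots,o^{-z}_T)$ with $o^{-z}_t=o_t$ for $t\ne\tau$ and $o^{-z}_\tau=o_\tau\setminus\{z\}$. Set $R^{-z}_0=R_{\mathrm{init}}$ and $R^{-z}_t=F(R^{-z}_{t-1},o^{-z}_t;\theta)$ for $1\le t\le T$. Exact unlearning operator. An unlearning operator is a map $U$ assigning to a final state and a target a new state (it may use the recorded runtime: observation log, dependency graph, checkpoints, environment snapshots). It is exact if $U(R_T,z)=R^{-z}_T$ (deterministic decoding). Checkpoint. A checkpoint at step $c$ is a record from which the stored real state $R_c$ can be restored; a clean boundary is a step $c\le\tau-1$. Tool observations are the components of observations returned by external tools; (A3) is the condition under which (A2) can be realized during replay. *)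

(* Defs.v *)
From mathcomp Require Import all_boot.
From mathcomp Require Import boolp classical_sets.

Set Implicit Arguments.
Unset Strict Implicit.
Unset Printing Implicit Defensive.

Local Open Scope classical_set_scope.

(* An observation is a set of items.  Streams and trajectories of length T are
   functions on nat of which only the values at 1..T (streams) or 0..T
   (trajectories) matter. *)
Definition stream (item : Type) := nat -> set item.

Section Trajectories.
Variables (item state : Type).
Implicit Types (o : stream item) (z : item) (R : nat -> state).

(* A step of the runtime is a priori nondeterministic (sampled decoding):
   G r x is the set of the possible successors of r on observation x. *)
Definition transition := state -> set item -> set state.
Implicit Type G : transition.

Definition single_valued G : Prop := forall r x, exists! r', G r x r'.

Definition run G o (a T : nat) R : Prop :=
  forall t, a < t <= T -> G (R t.-1) (o t) (R t).

Definition trajectory G (Rinit : state) o (T : nat) R : Prop :=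
  R 0 = Rinit /\ run G o 0 T R.

Definition first_enters o z (tau : nat) : Prop :=
  [/\ 1 <= tau, o tau z & forall t, 1 <= t < tau -> ~ o t z].

Definition counterfactual o z (tau : nat) : stream item :=
  fun t => if t == tau then o t `\ z else o t.

Definition replayed G o_san (tau T : nat) R R' : Prop :=
  R' tau.-1 = R tau.-1 /\ run G o_san tau.-1 T R'.

End Trajectories.

Section Environment.
Variable item : Type.

(* The external world the tools act on.  A call may change the world and
   returns a set of items.  Restoring a snapshot acts on the current world, and
   need not be able to undo every change made since the snapshot was taken. *)
Record environment := Environment {
  world : Type;
  call : Type;
  effect : call -> world -> world;
  response : call -> world -> set item;
  snapshot : Type;
  restore_env : snapshot -> world -> world
}.

Variable E : environment.
Implicit Types (o : stream item) (calls : nat -> call E) (w : nat -> world E).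

(* w t is the world after step t; the tool observations of step t are the part
   of o t returned by the calls of that step. *)
Definition environment_run o calls (T : nat) w : Prop :=
  forall t, 0 < t <= T ->
    w t = effect (calls t) (w t.-1) /\ response (calls t) (w t.-1) `<=` o t.

(* The side effect of step t is committed with respect to the snapshot s if it
   survives the restoration of s. *)
Definition committed_effect w (s : snapshot E) (t : nat) : Prop :=
  restore_env s (w t) <> restore_env s (w t.-1).

(* A snapshot taken at a clean boundary b restores, at the end of the session,
   the world of step b, and no step after tau has a committed side effect. *)
Definition no_committed_side_effects (snaps : nat -> option (snapshot E))
    w (tau T : nat) : Prop :=
  exists b s, [/\ b <= tau.-1, snaps b = Some s,
    restore_env s (w T) = w b &
    forall t, tau < t <= T -> ~ committed_effect w s t].

(* Reissuing the calls from a restored world reproduces the tool observations,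
   in particular those of steps tau..T. *)
Lemma tool_observations_reproducible o calls snaps w tau T :
    environment_run o calls T w ->
    no_committed_side_effects snaps w tau T ->
  exists b s, [/\ b <= tau.-1, snaps b = Some s &
    forall w' : nat -> world E,
      w' b = restore_env s (w T) ->
      (forall t, b < t <= T -> w' t = effect (calls t) (w' t.-1)) ->
      forall t, b < t <= T ->
        response (calls t) (w' t.-1) = response (calls t) (w t.-1)].
Proof.
move=> hw [b [s [hb hs hr _]]]; exists b, s; split=> // w' w'b hw'.
have eqw : forall t, b <= t -> t <= T -> w' t = w t.
  elim=> [|t IH]; first by rewrite leqn0 => /eqP <- _; rewrite w'b.
  rewrite leq_eqVlt => /orP[/eqP <- _|bt tT]; first by rewrite w'b.
  rewrite hw' ?bt //= IH //; last exact: ltnW.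
  by have [-> _] := hw t.+1 tT.
case=> [//|t] /andP[bt tT] /=; by rewrite eqw // ltnW.
Qed.

End Environment.

Section Unlearning.
Variables (item state checkpoint snap : Type).

(* deps t u: log entry u depends on log entry t. *)
Record recording := Recording {
  session_length : nat;
  log : stream item;
  deps : nat -> nat -> Prop;
  checkpoints : nat -> option checkpoint;
  snapshots : nat -> option snap
}.

Definition unlearning_operator := recording -> state -> item -> state.

(* R and Rcf are the real and the counterfactual trajectories. *)
Definition exact_unlearning (U : unlearning_operator) (rec : recording)
    (z : item) (R Rcf : nat -> state) : Prop :=
  U rec (R (session_length rec)) z = Rcf (session_length rec).

Variable restore : checkpoint -> state.

Definition checkpoints_restore (cks : nat -> option checkpoint) (T : nat)
    (R : nat -> state) : Prop :=
  forall c k, c <= T -> cks c = Some k -> restore k = R c.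

Definition clean_checkpoint_exists (cks : nat -> option checkpoint)
    (tau : nat) : Prop :=
  exists c k, c <= tau.-1 /\ cks c = Some k.

Fixpoint latest_checkpoint (cks : nat -> option checkpoint) (b : nat) :
    option (nat * checkpoint) :=
  match cks b, b with
  | Some k, _ => Some (b, k)
  | None, b'.+1 => latest_checkpoint cks b'
  | None, 0 => None
  end.

(* The first t in 1..T with z \in o t, or T.+1 if there is none. *)
Definition entry_step (o : stream item) (T : nat) (z : item) : nat :=
  (find (fun t => `[< o t z >]) (iota 1 T)).+1.

(* A successor of r under G, which is the successor when G is single-valued. *)
Definition successor (G : transition item state) (r : state) (x : set item) : state :=
  match pselect (exists r', G r x r') with
  | left e => sval (cid e)
  | right _ => r
  end.

(* Restore the latest clean checkpoint, then replay the logged observations up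
   to the entry step of z and the sanitized ones from that step on; san z is
   the sanitized stream for the target z. *)
Definition splice (G : transition item state) (san : item -> stream item) :
    unlearning_operator :=
  fun rec r z =>
    let T := session_length rec in
    let tau := entry_step (log rec) T z in
    let o t := if t < tau then log rec t else san z t in
    match latest_checkpoint (checkpoints rec) tau.-1 with
    | Some (c, k) =>
        foldl (fun r' t => successor G r' (o t)) (restore k) (iota c.+1 (T - c))
    | None => r
    end.

End Unlearning.

(* Main.v *)
(* Before step tau the real and the counterfactual streams coincide, so every
   state stored up to tau-1 is already a counterfactual state; from there on, a
   single-valued transition map propagates equality of states along equal
   observations. *)
Require Import Defs.
From mathcomp Require Import all_boot.
From mathcomp Require Import boolp classical_sets.


Set Implicit Arguments.
Unset Strict Implicit.
Unset Printing Implicit Defensive.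

Section Replay.
Variables (item state : Type) (G : transition item state).
Hypothesis G_sv : single_valued G.
Implicit Types (o : stream item) (R : nat -> state).

(** Agreement of the streams is asked only inside the window, so the lemma serves both for the
    prefix before the target enters and for the replay that follows. *)
Lemma run_unique o o' (a T : nat) R R' :
    run G o a T R -> run G o' a T R' -> R a = R' a ->
    (forall t, a < t <= T -> o t = o' t) ->
  forall t, a <= t <= T -> R t = R' t.
Proof.
move=> hR hR' eqa eqo t /andP[].
elim: t => [|t IH]; first by rewrite leqn0 => /eqP <- _.
rewrite leq_eqVlt => /predU1P[<- //|lt_at] le_tT.
have at_in : a < t.+1 <= T by rewrite lt_at.
have := hR t.+1 at_in; have := hR' t.+1 at_in.
rewrite /= eqo // IH //; last exact: ltnW.
have [r [_ uniq_r]] := G_sv (R' t) (o' t.+1).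
by move=> /uniq_r <- /uniq_r <-.
Qed.

Lemma successor_eq r x r' : G r x r' -> successor G r x = r'.
Proof.
move=> Gr'; rewrite /successor; case: pselect => [e|[]]; last by exists r'.
have [r0 [_ uniq_r0]] := G_sv r x.
by rewrite -(uniq_r0 _ Gr') -(uniq_r0 _ (svalP (cid e))).
Qed.

(** Bridge from runs, which are relational, to the fold computed by [splice]. The horizon has the
    form [c + n] so that the induction can move [c] up while [n] goes down. *)
Lemma foldl_successor o R (c n : nat) :
    run G o c (c + n) R ->
  foldl (fun r t => successor G r (o t)) (R c) (iota c.+1 n) = R (c + n).
Proof.
elim: n c => [|n IH] c hR /=; first by rewrite addn0.
have -> : successor G (R c) (o c.+1) = R c.+1.
  by apply/successor_eq/(hR c.+1); rewrite ltnSn addnS ltnS leq_addr.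
rewrite IH ?addSnnS // => t /andP[ct tn].
by apply: hR; rewrite ltnW // -addSnnS.
Qed.

End Replay.

Lemma counterfactual_before item (o : stream item) z tau t :
  t < tau -> counterfactual o z tau t = o t.
Proof. by move=> lt_t; rewrite /counterfactual ltn_eqF. Qed.

Lemma latest_checkpointP checkpoint (cks : nat -> option checkpoint) b :
    (exists c k, c <= b /\ cks c = Some k) ->
  exists c k,
    [/\ latest_checkpoint cks b = Some (c, k), c <= b & cks c = Some k].
Proof.
elim: b => [|b IH] [c [k [le_c ck]]] /=.
  by move: le_c ck; rewrite leqn0 => /eqP -> ck; exists 0, k; rewrite ck.
case cb: (cks b.+1) => [k'|]; first by exists b.+1, k'.
have [|c' [k' [eql le_c' ck']]] := IH.
  (* By [cb] the given checkpoint cannot sit at [b.+1], so it lies at or below [b]. *)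
  exists c, k; split=> //; move: le_c; rewrite leq_eqVlt => /predU1P[ec|//].
  by rewrite ec cb in ck.
by exists c', k'; split=> //; exact: leqW.
Qed.

Lemma entry_step_first_enters item (o : stream item) z tau T :
  tau <= T -> first_enters o z tau -> entry_step o T z = tau.
Proof.
case: tau => [|s] lt_sT [// _ ozs before].
rewrite /entry_step; congr _.+1.
set p := fun t => _; have p_s : p s.+1 by exact/asboolP.
have nth_p i : i < T -> nth 0 (iota 1 T) i = i.+1 by move=> ?; rewrite nth_iota.
have has_p : has p (iota 1 T).
  by apply/hasP; exists s.+1 => //; rewrite mem_iota add1n ltnS.
have lt_fT : find p (iota 1 T) < T.
  by move: has_p; rewrite has_find size_iota.
(* Index [i] of [iota 1 T] holds step [i.+1], so the index sought is [s]. A smaller one would be an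
   entry of [z] before [tau]; a larger one would mean that [find] skipped [s], where [p] holds. *)
case: (ltngtP (find p (iota 1 T)) s) => // [lt_fs|lt_sf].
- have := nth_find 0 has_p; rewrite nth_p // => /asboolP oz.
  by case: (before _ _ oz).
- by have := before_find 0 lt_sf; rewrite nth_p // p_s.
Qed.

Theorem theorem1
    (item state params checkpoint : Type) (E : environment item)
    (F : params -> transition item state) (theta : params)
    (Rinit : state) (T : nat) (o : stream item)
    (R : nat -> state) (hR : trajectory (F theta) Rinit o T R)
    (z : item) (tau : nat) (htau : tau <= T) (hz : first_enters o z tau)
    (Rcf : nat -> state)
    (hRcf : trajectory (F theta) Rinit (counterfactual o z tau) T Rcf)
    (* the recorded runtime *)
    (deps : nat -> nat -> Prop)
    (restore : checkpoint -> state) (cks : nat -> option checkpoint)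
    (hcks : checkpoints_restore restore cks T R)
    (hck : clean_checkpoint_exists cks tau)
    (snaps : nat -> option (snapshot E))
    (* the external environment during the session *)
    (calls : nat -> call E) (w : nat -> world E)
    (hw : environment_run o calls T w)
    (* sanitized observations and replayed trajectory *)
    (san : item -> stream item) (Rrep : nat -> state)
    (hRrep : replayed (F theta) (san z) tau T R Rrep)
    (A1 : single_valued (F theta))
    (A2 : forall t, tau <= t <= T -> san z t = counterfactual o z tau t)
    (A3 : no_committed_side_effects snaps w tau T) :
  let rec := Recording T o deps cks snaps in
  let U := splice restore (F theta) san in
  (forall t, tau.-1 <= t <= T -> Rrep t = Rcf t) /\
  Rrep T = Rcf T /\
  U rec (R T) z = Rrep T /\
  exact_unlearning U rec z R Rcf.
Proof.
move=> rec U; case: hR => R0 runR; case: hRcf => Rcf0 runRcf.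
case: hRrep => Rrep0 runRrep.
have tau_gt0 : 0 < tau by case: hz.
have eq_before t : t <= tau.-1 -> R t = Rcf t.
  move=> le_t; have lt_t : t < tau by rewrite -(prednK tau_gt0) ltnS.
  have tT : t <= T := leq_trans (ltnW lt_t) htau.
  (* The streams part at [tau], so both runs are cut at [t] before they are compared. *)
  have sub o' R' : run (F theta) o' 0 T R' -> run (F theta) o' 0 t R'.
    by move=> h s /andP[s0 st]; apply: h; rewrite s0 (leq_trans st).
  apply: (run_unique A1 (sub _ _ runR) (sub _ _ runRcf)).
  - by rewrite R0 Rcf0.
  - move=> s /andP[_ le_st]; rewrite counterfactual_before //.
    exact: leq_ltn_trans le_st lt_t.
  - by rewrite leqnn.
(* Used from [tau.-1] for the replay, and from the checkpoint step for the operator. *)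
have runRcf_from c : run (F theta) (counterfactual o z tau) c T Rcf.
  move=> t /andP[ct tT]; apply: runRcf.
  by rewrite tT (leq_ltn_trans (leq0n c) ct).
have eq_rep t : tau.-1 <= t <= T -> Rrep t = Rcf t.
  apply: (run_unique A1 runRrep (runRcf_from _)).
    by rewrite Rrep0 eq_before.
  by move=> s; rewrite prednK //; exact: A2.
have eqT : Rrep T = Rcf T.
  by apply: eq_rep; rewrite leqnn (leq_trans (leq_pred _)).
have UE : U rec (R T) z = Rcf T.
  rewrite /U /splice (entry_step_first_enters htau hz).
  have [c [k [-> le_c ck]]] := latest_checkpointP hck.
  have le_cT : c <= T := leq_trans le_c (leq_trans (leq_pred _) htau).
  (* The checkpoint may lie strictly before [tau.-1]. Its state is already counterfactual, so the
     fold only has to follow [Rcf]. *)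
  rewrite (hcks _ _ le_cT ck) eq_before //=.
  set o' := fun t => if t < tau then o t else san z t.
  (* It remains to see that [o'] is the counterfactual stream after [c]: the log before [tau], and
     (A2) from [tau] on. *)
  rewrite -[in RHS](subnKC le_cT); apply: (foldl_successor A1 (o := o')).
  rewrite subnKC // => t ctT; have := runRcf_from c t ctT.
  rewrite /o'; case: ltnP => [lt_tau|le_tau]; first by rewrite counterfactual_before.
  by rewrite A2 //; case/andP: ctT => _ ->; rewrite le_tau.
by split=> //; split=> //; split; rewrite ?eqT.
Qed.
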